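(* Let $k$ be a field and $a,b$ coprime positive integers such that $\mathrm{char}(k)$ is a divisor of $a$. Let $A=k[s^a,s^b]\subseteq k[s]$, $m_2=a(b-1)$, and let $\mathcal{H}_{\mathrm{HH}^*(A)}(x,y)=\sum_{(m,n)\in\mathbb{N}_0\times\mathbb{Z}}\dim_k(\mathbf{H}_{m,n})x^my^n$ be the Hilbert series of $\mathrm{HH}^*(A)$, where $\mathbf{H}_{m,n}$ is the component of cohomological degree $m$ and weight $n$. Then $$\mathcal{H}_{\mathrm{HH}^*(A)}(x,y)=\left(1+\frac{x^2y^{-ab}}{1-x^2y^{-ab}}\,(1-y^{m_2})\right)(1+xy^{-b})\,\mathrm{H}_1,\qquad \mathrm{H}_1=\frac{1-y^{ab}}{(1-y^a)(1-y^b)},$$ where $\mathrm{H}_1$ is the Hilbert series of $k[s^a,s^b]$.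
   Context: $\mathrm{HH}^*(A)=\bigoplus_{i\ge 0}\mathrm{Ext}^i_{A^e}(A,A)$, $A^e=A\otimes_k A^{op}$. It is bigraded by $\mathbb{N}_0\times\mathbb{Z}$: the first degree is cohomological, the second is the weight induced by giving $s$ weight $1$. Concretely, $\mathrm{HH}^*(A)$ is the cohomology of the complex with $k$-basis the elements $(e_It^{(q)},s^\alpha)$, $I\subseteq\{1,2\}$, $q\ge 0$, $\alpha\in S=\{ua+vb\mid u,v\in\mathbb{N}_0\}$, of bidegree $(|I|+2q,\ \alpha-b[1\in I]-a[2\in I]-qab)$ (with $[P]=1$ if $P$ is true and $0$ otherwise) and differential (as $a=0$ in $k$) $\partial(t^{(q)},s^\alpha)=\partial(e_1t^{(q)},s^\alpha)=0$, $\partial(e_2t^{(q)},s^\alpha)=-b(t^{(q+1)},s^{\alpha+m_2})$, $\partial(e_1\wedge e_2t^{(q)},s^\alpha)=b(e_1t^{(q+1)},s^{\alpha+m_2})$. Rational expressions are expanded as power series in $x$ with coefficients Laurent series in $y$. *)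

(* Defs.v *)
From mathcomp Require Import all_boot all_order all_algebra.
From mathcomp Require Import finmap monalg.
From mathcomp Require Import boolp classical_sets cardinality fsbigop.

Set Implicit Arguments.
Unset Strict Implicit.
Unset Printing Implicit Defensive.

Import Order.TTheory GRing.Theory Num.Theory.
Local Open Scope ring_scope.

(* [series] models Z((y))[[x]]: [f m n] is the coefficient of x^m y^n.  For
   each m, the series used below have [f m n = 0] for n << 0, so that the sum
   over j in the product [smul] has finite support (a finitely supported sum
   [\sum_(j \in _) _] would be 0 by convention otherwise). *)
Definition series := nat -> int -> int.

Definition sadd (f g : series) : series := fun m n => f m n + g m n.

Definition ssub (f g : series) : series := fun m n => f m n - g m n.

Definition smul (f g : series) : series := fun m n =>
  \sum_(i < m.+1) \sum_(j \in [set: int]) (f i j * g (m - i)%N (n - j)).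

(* x^i y^j *)
Definition smono (i : nat) (j : int) : series :=
  fun m n => ((m == i) && (n == j))%:R.

(* The expansion of 1 / (1 - x^i y^j), i.e. the sum of the x^(q i) y^(q j) over
   q >= 0, for (i, j) with i > 0 (power series in x), or i = 0 and j > 0
   (Laurent series in y). *)
Definition sgeom (i : nat) (j : int) : series :=
  fun m n => (`[< exists q : nat, m = (q * i)%N /\ n = q%:Z * j >])%:R.

Declare Scope series_scope.
Delimit Scope series_scope with S.
Bind Scope series_scope with series.
Notation "f + g" := (sadd f g) : series_scope.
Notation "f - g" := (ssub f g) : series_scope.
Notation "f * g" := (smul f g) : series_scope.
Notation "1" := (smono 0 0) : series_scope.

Lemma smul_monoE (i : nat) (j : int) (f : series) (m : nat) (n : int) :
  smul (smono i j) f m n = if (i <= m)%N then f (m - i)%N (n - j) else 0.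
Proof.
have E (i' : nat) : \sum_(j' \in [set: int])
    (smono i j i' j' * f (m - i')%N (n - j'))
    = (i' == i)%:R * f (m - i)%N (n - j).
  rewrite (fsbigTE [fset j]%fset).
    rewrite big_seq_fset1 /smono eqxx andbT.
    by case: eqP => [->//|_]; rewrite !mul0r.
  move=> j'; rewrite in_fset1 /smono => /negbTE ->.
  by rewrite andbF mul0r.
rewrite /smul; under eq_bigr do rewrite E.
case: leqP => h.
  rewrite (bigD1 (Ordinal (h : (i < m.+1)%N))) //= eqxx mul1r big1 ?addr0 //.
  move=> i' /eqP ne; case: eqP => [e|]; last by rewrite mul0r.
  by case: ne; apply: val_inj.
rewrite big1 // => i' _; case: eqP => [e|]; last by rewrite mul0r.
by have := ltn_ord i'; rewrite e ltnS leqNgt h.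
Qed.

(* [sgeom i j] is the inverse of 1 - x^i y^j. *)
Lemma sgeomE (i : nat) (j : int) : (0 < i)%N || (0 < j) ->
  sgeom i j = (1 + smono i j * sgeom i j)%S.
Proof.
move=> hij; apply/funext => m; apply/funext => n.
rewrite /sadd smul_monoE /sgeom /smono.
have [/andP[/eqP -> /eqP ->]|ne] := boolP ((m == 0%N) && (n == 0)).
  rewrite leqn0; case: asboolP => [_|[]]; last by exists 0%N; rewrite mul0r.
  case: eqP hij => [->/= j0|_ _]; last by rewrite addr0.
  case: asboolP => [[q [_]]|_]; last by rewrite addr0.
  move=> /eqP; rewrite sub0r eqr_oppLR -mulNr => /eqP e.
  move: j0; rewrite e ltNge => /negP[].
  have [j0|/ltW j0] := leP 0 j; last by rewrite -e.
  by rewrite mulNr oppr_le0 mulr_ge0.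
rewrite add0r; case: leqP => h; last first.
  case: asboolP => // -[[|q] [em en]]; move: ne h; rewrite em en.
    by rewrite !mul0r !mul0n.
  by rewrite mulSn ltnNge leq_addr.
congr (nat_of_bool _)%:R; apply: asbool_equiv_eq; split.
  case=> -[|q] [em en]; first by move: ne; rewrite em en mul0r mul0n !eqxx.
  exists q; rewrite em en mulSn addKn; split=> //.
  by rewrite -addn1 PoszD mulrDl mul1r addrK.
case=> q [em en]; exists q.+1; split; first by rewrite mulSn -em subnKC.
by rewrite -addn1 PoszD mulrDl mul1r -en subrK.
Qed.

(* For subspaces B <= Z of V: the quotient Z / B has dimension d. *)
Definition dim_quotient (k : fieldType) (V : lmodType k) (Z B : V -> Prop)
    (d : nat) : Prop :=
  exists v : 'I_d -> V, (forall i, Z (v i)) /\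
    forall z, Z z ->
      exists! c : 'rV[k]_d, B (z - \sum_(i < d) c ord0 i *: v i).

(* [h] is the Hilbert series of the bigraded space with components
   [Z m n / B m n]. *)
Definition is_hilbert_series (k : fieldType) (V : lmodType k)
    (Z B : nat -> int -> V -> Prop) (h : series) : Prop :=
  forall (m : nat) (n : int),
    exists d : nat, dim_quotient (Z m n) (B m n) d /\ h m n = d%:Z.

Section MonomialCurve.
Variables (k : fieldType) (a b : nat).

(* p \in k[s^a, s^b], i.e. p = q(s^a, s^b) for a polynomial q in two variables *)
Definition in_curve_alg (p : {poly k}) : Prop :=
  exists q : {poly {poly k}}, p = (map_poly (comp_poly 'X^a) q).['X^b].

(* Elements of k[s^a, s^b] homogeneous of bidegree (m, n), s^i having bidegree
   (0, i). *)
Definition curve_alg_comp (m : nat) (n : int) (p : {poly k}) : Prop :=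
  in_curve_alg p /\ forall i : nat, p`_i != 0 -> m = 0%N /\ n = i%:Z.

Definition is_hilbert_series_curve_alg (h : series) : Prop :=
  is_hilbert_series curve_alg_comp (fun _ _ p => p = 0) h.

Definition in_semigroup (n : nat) : Prop :=
  exists u v : nat, n = (u * a + v * b)%N.

(* (i1, i2, q, alpha) stands for (e_I t^(q), s^alpha), where i1 = [1 \in I] and
   i2 = [2 \in I]. *)
Definition cell : Type := (bool * bool * nat * nat)%type.

Definition cell_deg (e : cell) : nat :=
  let: (i1, i2, q, _) := e in (i1 + i2 + 2 * q)%N.

Definition cell_weight (e : cell) : int :=
  let: (i1, i2, q, alpha) := e in
  alpha%:Z - (b * i1)%N%:Z - (a * i2)%N%:Z - (q * a * b)%N%:Z.

Definition m2 : nat := (a * (b - 1))%N.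

(* The differential when a = 0 in k: the a-multiples of the general formula are
   omitted. *)
Definition cell_diff (e : cell) : {malg k[cell]} :=
  match e with
  | (false, true, q, alpha) =>
      - (b%:R *: << ((false, false, q.+1, (alpha + m2)%N) : cell) >>)
  | (true, true, q, alpha) =>
      b%:R *: << ((true, false, q.+1, (alpha + m2)%N) : cell) >>
  | (_, false, _, _) => 0
  end.

Definition HH_diff (c : {malg k[cell]}) : {malg k[cell]} :=
  \sum_(e <- msupp c) c@_e *: cell_diff e.

Lemma HH_diffK (c : {malg k[cell]}) : HH_diff (HH_diff c) = 0.
Proof.
rewrite {1}/HH_diff big1_seq // => -[[[i1 i2] q] alpha] /= h.
case: i2 h => [|_]; last by case: i1; rewrite scaler0.
rewrite -mcoeff_neq0 /HH_diff raddf_sum /= big1 ?eqxx //= => e _.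
rewrite mcoeffZ; case: e => [[[i1' []] q'] alpha'].
  by case: i1' => /=; rewrite ?mcoeffN mcoeffZ mcoeffU !xpair_eqE andbF ?mulr0
    ?oppr0 ?mulr0.
by case: i1' => /=; rewrite mcoeff0 mulr0.
Qed.

Definition HH_cocycle (m : nat) (n : int) (c : {malg k[cell]}) : Prop :=
  (forall e : cell, e \in msupp c ->
     [/\ in_semigroup e.2, cell_deg e = m & cell_weight e = n]) /\
  HH_diff c = 0.

(* For m = 0 only c' = 0 is allowed, so that c = 0. *)
Definition HH_coboundary (m : nat) (n : int) (c : {malg k[cell]}) : Prop :=
  exists c' : {malg k[cell]},
    (forall e : cell, e \in msupp c' ->
       [/\ in_semigroup e.2, (cell_deg e).+1 = m & cell_weight e = n]) /\
    c = HH_diff c'.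

(* The Hilbert series of HH^*(k[s^a, s^b]), computed by the complex with basis
   [cell] and differential [HH_diff]. *)
Definition is_hilbert_series_HH (h : series) : Prop :=
  is_hilbert_series HH_cocycle HH_coboundary h.

End MonomialCurve.

(* H_1 = (1 - y^(ab)) / ((1 - y^a) (1 - y^b)) *)
Definition H1 (a b : nat) : series :=
  ((1 - smono 0 (a * b)%N%:Z) * (sgeom 0 a%:Z * sgeom 0 b%:Z))%S.

(* Main.v *)
Require Import Defs.
From mathcomp Require Import all_boot all_order all_algebra.
From mathcomp Require Import finmap monalg.
From mathcomp Require Import boolp classical_sets cardinality fsbigop.
From mathcomp Require Import zify.

Set Implicit Arguments.
Unset Strict Implicit.
Unset Printing Implicit Defensive.

Import Order.TTheory GRing.Theory Num.Theory.
Local Open Scope ring_scope.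

(** Since p divides a and a, b are coprime, b is invertible in k.  Hence the
    differential is injective on the cells with 2 in I, and the cocycles are
    spanned by the cells with 2 not in I.  In a given bidegree there is at most
    one such cell: m fixes [1 in I] and q, then n fixes alpha.  It is a
    coboundary iff q > 0 and alpha lies in S + m2, so each component has
    dimension 0 or 1.  On the series side, H_1 is the sum of the y^alpha with
    alpha in S, and the remaining factor is a Laurent polynomial in y in each
    x-degree m: y^(-s), minus y^(m2 - s) if m > 1, for a shift s depending on m.
*)

(** * Products of series by Laurent polynomials *)

(* A Laurent polynomial is given as a sequence of pairs (coefficient, exponent). *)
Lemma fsbig_laurent (L : seq (int * int)) (f g : int -> int) :
    (forall j, f j = \sum_(t <- L) t.1 * (j == t.2)%:R) ->
  \sum_(j \in [set: int]) f j * g j = \sum_(t <- L) t.1 * g t.2.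
Proof.
move=> fE; rewrite (fsbigTE [fset t.2 | t in L]%fset); last first.
  move=> j jL; rewrite fE big_seq big1 ?mul0r // => t tL.
  have [e|] := eqVneq j t.2; last by rewrite mulr0.
  by move: jL; rewrite e in_imfset.
under eq_bigr do rewrite fE mulr_suml.
rewrite exchange_big /= big_seq [RHS]big_seq; apply: eq_bigr => t tL.
rewrite (big_fsetD1 t.2) /= ?in_imfset // eqxx mulr1 big_seq big1 ?addr0 // => j.
by rewrite !inE => /andP[/negbTE -> _]; rewrite mulr0 mul0r.
Qed.

Lemma smulC (f g : series) : smul f g = smul g f.
Proof.
apply/funext => m; apply/funext => n; rewrite /smul (reindex_inj rev_ord_inj) /=.
apply: eq_bigr => i _; have im : (i <= m)%N by rewrite -ltnS.
rewrite subSS (reindex_fsbigT (fun j : int => n - j)) /=; last first.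
  by exists (fun j : int => n - j) => j; rewrite subKr.
by apply: eq_fsbigr => j _; rewrite subKr subKn // mulrC.
Qed.

Lemma smul_laurent0 (f g : series) (L : seq (int * int)) (m : nat) (n : int) :
    (forall j, f m j = \sum_(t <- L) t.1 * (j == t.2)%:R) ->
    (forall i j, (0 < i)%N -> g i j = 0) ->
  smul f g m n = \sum_(t <- L) t.1 * g 0%N (n - t.2).
Proof.
move=> fE g0; rewrite /smul big_ord_recr /= big1 ?add0r => [|i _]; last first.
  by apply: fsbig1 => j _; rewrite g0 ?mulr0 // subn_gt0.
by rewrite (fsbig_laurent (fun j => g (m - m)%N (n - j)) fE) subnn.
Qed.

(** Distributivity fails for arbitrary series, since an infinitely supported sum is 0 by convention.
    Here both summands are monomials, so every sum over the exponent of y is finite. *)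
Lemma smul_monoD (i i' : nat) (j j' : int) (f : series) :
  smul (sadd (smono i j) (smono i' j')) f
  = sadd (smul (smono i j) f) (smul (smono i' j') f).
Proof.
apply/funext => m; apply/funext => n; rewrite /sadd /smul -big_split /=.
apply: eq_bigr => l _.
rewrite (@fsbig_laurent [:: ((l == i :> nat)%:R, j); ((l == i' :> nat)%:R, j')]
  _ (fun x => f (m - l)%N (n - x))) => [|x]; last first.
  by rewrite !big_cons big_nil addr0 /= /smono -!natrM !mulnb.
rewrite (@fsbig_laurent [:: ((l == i :> nat)%:R, j)] _
  (fun x => f (m - l)%N (n - x))) => [|x]; last first.
  by rewrite !big_cons big_nil addr0 /= /smono -!natrM !mulnb.
rewrite (@fsbig_laurent [:: ((l == i' :> nat)%:R, j')] _
  (fun x => f (m - l)%N (n - x))) => [|x]; last first.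
  by rewrite !big_cons big_nil addr0 /= /smono -!natrM !mulnb.
by rewrite !big_cons !big_nil !addr0.
Qed.

Lemma smul_monoB (i i' : nat) (j j' : int) (f : series) :
  smul (ssub (smono i j) (smono i' j')) f
  = ssub (smul (smono i j) f) (smul (smono i' j') f).
Proof.
apply/funext => m; apply/funext => n; rewrite /ssub /smul -sumrB.
apply: eq_bigr => l _.
rewrite (@fsbig_laurent [:: ((l == i :> nat)%:R, j); (- (l == i' :> nat)%:R, j')]
  _ (fun x => f (m - l)%N (n - x))) => [|x]; last first.
  by rewrite !big_cons big_nil addr0 /= /smono mulNr -!natrM !mulnb.
rewrite (@fsbig_laurent [:: ((l == i :> nat)%:R, j)] _
  (fun x => f (m - l)%N (n - x))) => [|x]; last first.
  by rewrite !big_cons big_nil addr0 /= /smono -!natrM !mulnb.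
rewrite (@fsbig_laurent [:: ((l == i' :> nat)%:R, j')] _
  (fun x => f (m - l)%N (n - x))) => [|x]; last first.
  by rewrite !big_cons big_nil addr0 /= /smono -!natrM !mulnb.
by rewrite !big_cons !big_nil !addr0 mulNr.
Qed.

(** * The series [H1] as the indicator of the semigroup *)

Definition int_semigroup (a b : nat) (z : int) : Prop :=
  exists u v : nat, z = (u * a + v * b)%N%:Z.

Lemma sgeom0E (j : nat) (m : nat) (n : int) : (0 < j)%N ->
  sgeom 0 j%:Z m n = [&& m == 0%N, 0 <= n & (j %| `|n|)%N]%:R.
Proof.
move=> j0; congr (nat_of_bool _)%:R; apply/asboolP/and3P => [[q [-> ->]]|].
  by rewrite muln0 -PoszM /= dvdn_mull.
case=> /eqP -> n0 /dvdnP[q nq]; exists q; split; first by rewrite muln0.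
by rewrite -PoszM -nq gez0_abs.
Qed.

(** The coefficient counts the decompositions of [n] into a nonnegative multiple of [a] and one of
    [b]; only 0 <= j <= n can contribute. *)
Lemma smul_sgeom0 (a b m : nat) (n : int) : (0 < a)%N -> (0 < b)%N ->
  smul (sgeom 0 a%:Z) (sgeom 0 b%:Z) m n
  = if (m == 0%N) && (0 <= n)
    then \sum_(0 <= j < `|n|.+1) ((a %| j)%N && (b %| `|n| - j)%N)%:R else 0.
Proof.
move=> a0 b0; have [->|m0] := eqVneq m 0%N; last first.
  rewrite /smul big1 // => i _; apply: fsbig1 => j _.
  rewrite !sgeom0E //; case: eqP => [->|]; last by rewrite mul0r.
  by rewrite subn0 (negbTE m0) mulr0.
rewrite /smul big_ord1 subnn; case: n => n /=; last first.
  apply: fsbig1 => j _; rewrite !sgeom0E //.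
  by case: leP; rewrite ?mul0r // => j0; rewrite [_ <= _ - _]lt_geF ?mulr0 //; lia.
pose h j := (a %| j)%N && (b %| n - j)%N.
(* [L] presents the whole summand, as a function of [j], as a Laurent polynomial; pairing it with
   the constant 1 then gives a sum over 0 <= j <= n. *)
pose L := [seq ((h j)%:R : int, j%:Z) | j <- index_iota 0 n.+1].
have E j : sgeom 0 a%:Z 0 j * sgeom 0 b%:Z 0 (n%:Z - j)
    = \sum_(t <- L) t.1 * (j == t.2)%:R.
  rewrite !sgeom0E // big_map /=; case: j => [j|j]; last first.
    by rewrite mul0r big1 // => i _; rewrite mulr0.
  have [jn|jn] := leqP j n; last first.
    rewrite [0 <= _ - _]lt_geF ?mulr0; last by lia.
    rewrite big_seq big1 // => i; rewrite mem_index_iota => /andP[_ iN].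
    by rewrite eqz_nat gtn_eqF ?mulr0 //; lia.
  rewrite (bigD1_seq j) ?iota_uniq ?mem_index_iota //= eqxx mulr1 big1 => [|i ij].
    rewrite addr0 /h -natrM mulnb subzn //=.
  by rewrite eqz_nat eq_sym (negbTE ij) mulr0.
transitivity (\sum_(t <- L) t.1 * 1); last first.
  by rewrite big_map /=; apply: eq_bigr => i _; rewrite mulr1.
rewrite -(fsbig_laurent (fun=> 1) E).
by apply: eq_fsbigr => j _; rewrite mulr1.
Qed.

(* The j with a | j and b | n - j are all congruent modulo ab, so the sum has at
   most one nonzero term. *)
Lemma sum_dvdn_lt (a b n : nat) : (0 < a)%N -> (0 < b)%N -> coprime a b ->
  \sum_(0 <= j < minn (a * b) n.+1) ((a %| j)%N && (b %| n - j)%N)%:R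
  = (`[< in_semigroup a b n >])%:R :> int.
Proof.
move=> a0 b0 ab; case: asboolP => [[u [v nE]]|nS]; last first.
  rewrite big_nat big1 // => j /andP[_ jn].
  case: andP => // -[/dvdnP[u ju] /dvdnP[v jv]]; case: nS; exists u, v; lia.
(* Reducing [u] modulo [b] moves multiples of [a * b] into the part divisible by [b], giving the
   decomposition with first part below [a * b]. *)
pose j0 := ((u %% b) * a)%N.
have ule : (u %% b <= u)%N by exact: leq_mod.
have j0n : (j0 <= n)%N by rewrite nE /j0; nia.
have j0ab : (j0 < a * b)%N by rewrite (mulnC a) ltn_pmul2r // ltn_mod.
rewrite (bigD1_seq j0) ?iota_uniq ?mem_index_iota /= ?leq_min ?ltnS ?j0n ?j0ab //.
have bj0 : (b %| n - j0)%N.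
  have -> : (n - j0 = (u %/ b * a + v) * b)%N.
    rewrite nE /j0 {1}(divn_eq u b) mulnDl; nia.
  exact: dvdn_mull.
rewrite bj0 dvdn_mull //= big_nat_cond big1 ?addr0 // => j /andP[/andP[_ jlt] jj0].
case: andP => // -[aj bj]; case/negP: jj0.
move: jlt; rewrite leq_min ltnS => /andP[jab jn].
have aj0 : (a %| j0)%N by exact: dvdn_mull.
(* Once its definition is forgotten, [j0] satisfies the same conditions as [j], so the two can be
   exchanged. *)
move: jab aj bj j0ab aj0 bj0; clearbody j0.
wlog jj0 : j j0 j0n jn / (j <= j0)%N => [h|].
  case/orP: (leq_total j j0) => l *; first exact: (h j j0).
  by rewrite eq_sym; apply: (h j0 j).
move=> jab aj bj j0ab aj0 bj0.
have : (a * b %| j0 - j)%N.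
  rewrite Gauss_dvd // dvdn_sub //=.
  have -> : (j0 - j = (n - j) - (n - j0))%N by clear -jj0 j0n jn; lia.
  exact: dvdn_sub.
have [/eqP + _|lt0 /(dvdn_leq lt0) le] := posnP (j0 - j).
  by rewrite subn_eq0 eqn_leq jj0 => ->.
by move: (leq_trans j0ab (leq_trans le (leq_subr j j0))); rewrite ltnn.
Qed.

(** The factor 1 - y^(ab) subtracts the count at n - ab. After the shift of j by ab this is the part
    j >= ab of the count at n, which leaves the sum of [sum_dvdn_lt]. *)
Lemma H1E (a b m : nat) (n : int) : (0 < a)%N -> (0 < b)%N -> coprime a b ->
  H1 a b m n = (m == 0%N)%:R * (`[< int_semigroup a b n >])%:R.
Proof.
move=> a0 b0 ab; rewrite /H1 smul_monoB /ssub !smul_monoE !leq0n !subn0 subr0.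
rewrite !smul_sgeom0 //; case: eqP => [_|_]; last by rewrite mul0r subrr.
rewrite mul1r /=; case: n => n /=; last first.
  rewrite [0 <= _]lt_geF ?subrr; last by lia.
  by case: asboolP => // -[u [v]].
have -> : `[< int_semigroup a b n >] = `[< in_semigroup a b n >].
  apply: asbool_equiv_eq; split=> -[u [v e]]; exists u, v; last by rewrite e.
  by case: e.
rewrite -sum_dvdn_lt //.
have [abn|nab] := leqP (a * b) n; last first.
  rewrite [0 <= _]lt_geF ?subr0; last by lia.
  by rewrite (minn_idPr _).
rewrite subzn //= (minn_idPl _) ?(leq_trans abn) //.
rewrite (@big_cat_nat _ _ _ (a * b)) /= ?(leq_trans abn) //.
have -> : \sum_(a * b <= j < n.+1) ((a %| j)%N && (b %| n - j)%N)%:R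
    = \sum_(0 <= j < (n - a * b).+1)
        ((a %| j)%N && (b %| n - a * b - j)%N)%:R :> int; last by rewrite addrK.
rewrite -[X in \sum_(X <= _ < _) _]add0n big_addn subSn //.
apply: eq_bigr => j _; rewrite dvdn_addl ?dvdn_mulr //.
by rewrite (addnC j) subnDA.
Qed.

(** * The factor of the Hilbert series other than [H1] *)

(** The leading monomial makes the geometric sum start at q = 1, where q is [m./2]; hence the
    condition [1 < m]. *)
Lemma smono_sgeom2E (c m : nat) (n : int) :
  smul (smono 2 (- c%:Z)) (sgeom 2 (- c%:Z)) m n
  = [&& (1 < m)%N, ~~ odd m & n == - (m./2 * c)%N%:Z]%:R.
Proof.
rewrite smul_monoE; case: m => [|[|m]] //=; rewrite !subSS subn0 negbK /sgeom.
congr (nat_of_bool _)%:R; apply/asboolP/andP => [[q [mE nE]]|[em /eqP nE]].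
  rewrite mE muln2 odd_double doubleK; split=> //; apply/eqP; lia.
exists m./2; split; last by lia.
by rewrite muln2 -[LHS]odd_double_half (negbTE em).
Qed.

(* A cell (e_I t^(q), s^alpha) of degree m with 2 not in I has weight
   alpha - HH_shift a b m. *)
Definition HH_shift (a b m : nat) : nat := (b * odd m + m./2 * (a * b))%N.

(** The first factor has only even degrees in x, so the parity of [m] selects the term 1 or x y^(-b)
    of the second factor. *)
Lemma HH_factorE (a b m : nat) (n : int) :
  smul (1 + smono 2 (- (a * b)%N%:Z) * sgeom 2 (- (a * b)%N%:Z)
            * (1 - smono 0 (m2 a b)%:Z))%S (1 + smono 1 (- b%:Z))%S m n
  = (n == - (HH_shift a b m)%:Z)%:R
    - ((1 < m)%N && (n == (m2 a b)%:Z - (HH_shift a b m)%:Z))%:R.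
Proof.
(* Commutativity brings the two-term factor to the left, where it distributes. *)
rewrite smulC smul_monoD {1}/sadd !smul_monoE leq0n subn0 subr0.
rewrite (smulC (smul _ _)) smul_monoB /ssub /sadd.
rewrite !(smul_monoE 0) !leq0n !subn0 !subr0 !smono_sgeom2E /smono /HH_shift.
set c := (a * b)%N; set e := m2 a b; clearbody c e.
case: m => [|[|m]] /=.
- by rewrite muln0 mul0n addn0 oppr0 !subr0.
- by rewrite muln1 mul0n addn0 !subr0 add0r opprK -addr_eq0.
rewrite uphalf_half !add0r !negbK subSS subn0 ltnS.
have [om|em] := boolP (odd m); rewrite /= ?subr0 ?addr0 ?add0r.
  rewrite (odd_gt0 om) muln1 /=.
  by congr ((nat_of_bool _)%:R - (nat_of_bool _)%:R); apply/eqP/eqP; lia.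
rewrite andbF subr0 muln0 add0n.
by congr ((nat_of_bool _)%:R - (nat_of_bool _)%:R); apply/eqP/eqP; lia.
Qed.

Lemma HH_seriesE (a b m : nat) (n : int) :
  (0 < a)%N -> (0 < b)%N -> coprime a b ->
  ((1 + smono 2 (- (a * b)%N%:Z) * sgeom 2 (- (a * b)%N%:Z)
            * (1 - smono 0 (m2 a b)%:Z))
     * (1 + smono 1 (- b%:Z)) * H1 a b)%S m n
  = (`[< int_semigroup a b (n + (HH_shift a b m)%:Z) >])%:R
    - ((1 < m)%N
       && `[< int_semigroup a b (n + (HH_shift a b m)%:Z - (m2 a b)%:Z) >])%:R.
Proof.
move=> a0 b0 ab.
rewrite (@smul_laurent0 _ _ [:: (1, - (HH_shift a b m)%:Z);
   (- (1 < m)%:R, (m2 a b)%:Z - (HH_shift a b m)%:Z)]) => [|j|i j i0].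
- rewrite !big_cons big_nil addr0 /= !H1E // eqxx !mul1r mulNr -natrM mulnb.
  by rewrite opprK opprB addrA addrAC.
- by rewrite HH_factorE !big_cons big_nil addr0 /= mul1r mulNr -natrM mulnb.
by rewrite H1E // gtn_eqF ?mul0r.
Qed.

(** * Quotients of dimension 0 and 1 *)

Lemma dim_quotient0 (k : fieldType) (V : lmodType k) (Z B : V -> Prop) :
  (forall z, Z z -> B z) -> dim_quotient Z B 0.
Proof.
move=> ZB; exists (fun=> 0); split=> [[]//|z /ZB Bz].
exists 0; split; first by rewrite big_ord0 subr0.
by move=> c _; apply/rowP => i; case: (i) => [].
Qed.

Lemma dim_quotient1 (k : fieldType) (V : lmodType k) (Z B : V -> Prop) (v : V) :
    Z v -> (forall z, Z z -> exists! c : k, B (z - c *: v)) ->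
  dim_quotient Z B 1.
Proof.
move=> Zv ZB; exists (fun=> v); split=> // z /ZB[c [Bc cU]].
exists (const_mx c); split; first by rewrite big_ord1 mxE.
move=> c'; rewrite big_ord1 => /cU ->.
by apply/rowP => i; rewrite mxE (ord1 i).
Qed.

(** * The differential in coordinates *)

Lemma malgZU (R : nzRingType) (K : choiceType) (x : R) (e : K) :
  x *: (<< e >> : {malg R[K]}) = << x *g e >>.
Proof. by apply/malgP => e'; rewrite mcoeffZ !mcoeffU mulrnAr mulr1. Qed.

Lemma HH_diff0 (k : fieldType) (a b : nat) :
  HH_diff a b (0 : {malg k[cell]}) = 0.
Proof. by rewrite /HH_diff msupp0 big_seq_fset0. Qed.

Lemma HH_diffU (k : fieldType) (a b : nat) (x : k) (e : cell) :
  HH_diff a b << x *g e >> = x *: cell_diff k a b e.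
Proof.
rewrite /HH_diff msuppU; case: eqP => [->|_]; first by rewrite scale0r big_seq_fset0.
by rewrite big_seq_fset1 mcoeffUU.
Qed.

(** This is the coefficient in the two nonzero cases of [cell_diff], which can thus be treated
    together. *)
Definition HH_sign (k : fieldType) (b : nat) (i1 : bool) : k :=
  if i1 then b%:R else - b%:R.

Lemma cell_diff_e2 (k : fieldType) (a b : nat) (i1 : bool) (q alpha : nat) :
  cell_diff k a b (i1, true, q, alpha)
  = HH_sign k b i1 *: << ((i1, false, q.+1, (alpha + m2 a b)%N) : cell) >>.
Proof. by case: i1; rewrite // scaleNr. Qed.

(** Distinct cells with 2 in I have distinct targets, so a single term of the sum reaches the given
    cell. *)
Lemma mcoeff_HH_diff (k : fieldType) (a b : nat) (c : {malg k[cell]})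
    (i1 : bool) (q alpha : nat) :
  (HH_diff a b c)@_((i1, false, q.+1, (alpha + m2 a b)%N) : cell)
  = HH_sign k b i1 * c@_((i1, true, q, alpha) : cell).
Proof.
set e0 : cell := (i1, true, q, alpha).
rewrite /HH_diff raddf_sum /=.
have E (e : cell) : (c@_e *: cell_diff k a b e)@_((i1, false, q.+1, (alpha + m2 a b)%N) : cell)
    = (e == e0)%:R * (HH_sign k b i1 * c@_e0).
  rewrite mcoeffZ; case: e => [[[j1 j2] r] beta].
  case: j2; last by case: j1; rewrite mcoeff0 mulr0 !xpair_eqE andbF mul0r.
  rewrite cell_diff_e2 mcoeffZ mcoeffU !xpair_eqE eqn_add2r eqSS !eqxx !andbT.
  case: andP => [[/andP[/eqP -> /eqP ->] /eqP ->]|_]; last by rewrite !mulr0 mul0r.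
  by rewrite mulr1 mul1r mulrC.
under eq_bigr do rewrite E.
have [e0c|e0c] := boolP (e0 \in msupp c); last first.
  by rewrite (mcoeff_outdom e0c) mulr0 big1 // => e _; rewrite mulr0.
rewrite (big_fsetD1 e0) //= eqxx mul1r big_seq big1 ?addr0 // => e.
by rewrite !inE => /andP[/negbTE -> _]; rewrite mul0r.
Qed.

Lemma msupp_HH_diff (k : fieldType) (a b : nat) (c : {malg k[cell]}) (e : cell) :
    e \in msupp (HH_diff a b c) ->
  exists (i1 : bool) (q alpha : nat), e = (i1, false, q.+1, (alpha + m2 a b)%N)
    /\ ((i1, true, q, alpha) : cell) \in msupp c.
Proof.
rewrite -mcoeff_neq0; apply: contra_neqP => h.
rewrite /HH_diff raddf_sum /= big_seq big1 // => -[[[i1 i2] q] alpha] ec.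
rewrite mcoeffZ; case: i2 ec => ec; last by case: i1 ec; rewrite mcoeff0 mulr0.
rewrite cell_diff_e2 mcoeffZ mcoeffU; case: eqP => [e'|]; last by rewrite !mulr0.
by case: h; exists i1, q, alpha.
Qed.

Lemma malg_supp1 (k : fieldType) (K : choiceType) (c : {malg k[K]}) (e : K) :
  (forall e', e' \in msupp c -> e' = e) -> c = << c@_e *g e >>.
Proof.
move=> h; apply/malgP => e'; rewrite mcoeffU.
case: eqP => [->//|ne]; rewrite mulr0n; apply: mcoeff_outdom.
by apply/negP => /h /esym.
Qed.

(** * Cocycles, coboundaries and dimensions of the components *)

Section Cohomology.
Variables (k : fieldType) (a b : nat).
Hypothesis b_neq0 : b%:R != 0 :> k.

Lemma HH_sign_neq0 (i1 : bool) : HH_sign k b i1 != 0.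
Proof. by case: i1; rewrite /HH_sign ?oppr_eq0. Qed.

(* The differential is injective on the cells with 2 \in I, as b is invertible
   in k and the shift of alpha by m2 is injective. *)
Lemma HH_cocycle_supp (m : nat) (n : int) (c : {malg k[cell]}) (e : cell) :
    HH_cocycle a b m n c -> e \in msupp c ->
  exists alpha : nat, [/\ e = (odd m, false, m./2, alpha), in_semigroup a b alpha
    & alpha%:Z = n + (HH_shift a b m)%:Z].
Proof.
case=> hc dc ec; have := hc e ec; case: e ec => [[[i1 [|]] q] alpha] ec.
  move: ec; rewrite -mcoeff_neq0 => /negP[].
  have := mcoeff_HH_diff a b c i1 q alpha.
  by rewrite dc mcoeff0 => /esym/eqP; rewrite mulf_eq0 (negbTE (HH_sign_neq0 i1)).
rewrite /= addn0 mul2n muln0 subr0 => -[sS <- <-]; exists alpha.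
(* The degree i1 + 2q determines i1 as its parity and q as its half. *)
rewrite /HH_shift oddD odd_double addbF oddb half_bit_double; split=> //.
by rewrite mulnA; lia.
Qed.

Lemma HH_cocycleU (m : nat) (n : int) (alpha : nat) :
    in_semigroup a b alpha -> alpha%:Z = n + (HH_shift a b m)%:Z ->
  HH_cocycle a b m n (<< ((odd m, false, m./2, alpha) : cell) >> : {malg k[cell]}).
Proof.
move=> aS aE; split=> [e|]; last first.
  by rewrite HH_diffU scale1r; case: (odd m).
rewrite msuppU oner_eq0 inE => /eqP ->; split=> //=.
  by rewrite addn0 mul2n odd_double_half.
rewrite muln0 aE /HH_shift; lia.
Qed.

Lemma HH_coboundary0 (m : nat) (n : int) :
  HH_coboundary a b m n (0 : {malg k[cell]}).
Proof.
exists 0; split; last by rewrite HH_diff0.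
by move=> e; rewrite msupp0 inE.
Qed.

Lemma HH_coboundaryU (m : nat) (n : int) (x : k) (alpha beta : nat) :
    (1 < m)%N -> in_semigroup a b beta -> (alpha = beta + m2 a b)%N ->
    alpha%:Z = n + (HH_shift a b m)%:Z ->
  HH_coboundary a b m n << x *g ((odd m, false, m./2, alpha) : cell) >>.
Proof.
move=> m1 bS aE nE; have m0 : (0 < m./2)%N by rewrite half_gt0.
(* The preimage trades one factor t, available as [1 < m], for e_2 and lowers the exponent by [m2];
   the division by the unit [HH_sign] cancels the coefficient of the differential. *)
exists << x / HH_sign k b (odd m) *g ((odd m, true, m./2.-1, beta) : cell) >>.
split=> [e|].
  rewrite msuppU; case: eqP => _; rewrite inE // => /eqP ->; split=> //=.
    by rewrite -{3}(odd_double_half m) -{2}(prednK m0); lia.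
  (* The trade preserves the weight because m2 + a = ab. This needs [b] positive, which follows from
     [b_neq0]. *)
  have e1 : (a * (b - 1) + a = a * b)%N.
    by rewrite -mulnSr subn1 prednK // lt0n; apply: contraNneq b_neq0 => ->.
  have e2 : (m./2 * (a * b) = m./2.-1 * a * b + a * b)%N.
    by rewrite -{1}(prednK m0) mulSn addnC mulnA.
  by move: nE; rewrite aE /HH_shift /m2 e2; lia.
rewrite HH_diffU cell_diff_e2 scalerA divfK ?HH_sign_neq0 // prednK // -aE.
by rewrite malgZU.
Qed.

(** The source of the cell has 2 in I, hence degree at least 1, so its image has degree at least
    2. *)
Lemma HH_coboundary_supp (m : nat) (n : int) (c : {malg k[cell]}) (e : cell) :
    HH_coboundary a b m n c -> e \in msupp c ->
  [/\ (1 < m)%N & exists2 beta, in_semigroup a b beta &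
     e.2 = (beta + m2 a b)%N].
Proof.
case=> c' [hc' ->] /msupp_HH_diff[i1 [q [alpha [-> /hc'[/= aS <- _]]]]]; split; last by exists alpha.
by rewrite addn1 addSn.
Qed.


Lemma HH_hilbert_comp (m : nat) (n : int) : (0 < b)%N ->
  exists d : nat, dim_quotient (@HH_cocycle k a b m n) (HH_coboundary a b m n) d
    /\ (`[< int_semigroup a b (n + (HH_shift a b m)%:Z) >])%:R
       - ((1 < m)%N && `[< int_semigroup a b
           (n + (HH_shift a b m)%:Z - (m2 a b)%:Z) >])%:R = d%:Z.
Proof.
move=> b0; set w := n + _.
case: (asboolP (int_semigroup a b w)) => [[u [v wE]]|wS]; last first.
  exists 0%N; split.
    apply: dim_quotient0 => z Zz; suff -> : z = 0 by exact: HH_coboundary0.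
    apply/malgP => e; rewrite mcoeff0; apply: mcoeff_outdom.
    apply/negP => /(HH_cocycle_supp Zz)[alpha [_ [u [v aE]] wE]].
    by case: wS; exists u, v; rewrite /w -wE aE.
  (* As m2 = (b - 1)a lies in S, having w - m2 in S would put w in S; so the subtracted indicator
     vanishes too. *)
  case: asboolP => [[u [v e]]|_]; last by rewrite andbF subrr.
  case: wS; exists (u + (b - 1))%N, v; move: e; rewrite /m2; nia.
have aS : in_semigroup a b (u * a + v * b) by exists u, v.
pose e0 : cell := (odd m, false, m./2, (u * a + v * b)%N).
have Z1 (z : {malg k[cell]}) : HH_cocycle a b m n z -> z = << z@_e0 *g e0 >>.
  move=> Zz; apply: malg_supp1 => e /(HH_cocycle_supp Zz)[alpha [-> _ aE]].
  by congr (_, _); apply/eqP; rewrite -eqz_nat aE -/w wE.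
case: andP => [[m1 /asboolP[u' [v' e]]]|wB].
  exists 0%N; split; last by rewrite subrr.
  apply: dim_quotient0 => z /Z1 ->.
  by apply: (@HH_coboundaryU _ _ _ _ (u' * a + v' * b)) => //; [exists u', v'|lia].
exists 1%N; split; last by rewrite subr0.
(* The coefficient at [e0] vanishes on coboundaries, which makes the scalar in the quotient
   unique. *)
have zB (z : {malg k[cell]}) : HH_coboundary a b m n z -> z@_e0 = 0.
  move=> Bz; apply/eqP; rewrite -[_ == _]negbK mcoeff_neq0; apply/negP.
  case/(HH_coboundary_supp Bz) => m1 [_ [u' [v' ->]] /= e]; case: wB; split=> //.
  by apply/asboolP; exists u', v'; lia.
apply: (@dim_quotient1 _ _ _ _ << e0 >>); first exact: HH_cocycleU.
move=> z Zz; exists z@_e0; split.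
  suff -> : z - z@_e0 *: << e0 >> = 0 by exact: HH_coboundary0.
  by rewrite {1}(Z1 z Zz) malgZU subrr.
move=> c /zB; rewrite mcoeffB mcoeffZ mcoeffUU mulr1 => /eqP.
by rewrite subr_eq0 => /eqP.
Qed.

End Cohomology.

(** * The Hilbert series of the curve algebra *)

(** A monomial of q with exponents u and v contributes only to the power ua + vb of s. *)
Lemma in_curve_alg_coef (k : fieldType) (a b : nat) (p : {poly k}) (i : nat) :
  (0 < a)%N -> (0 < b)%N -> in_curve_alg a b p -> p`_i != 0 -> in_semigroup a b i.
Proof.
move=> a0 b0 [q ->]; apply: contra_neqP => iS.
rewrite horner_coef coef_sum big1 // => j _.
rewrite coef_map_id0 ?comp_poly0 // -exprM coefMXn coef_comp_poly_Xn //.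
case: ltnP => // ji; case: dvdnP => // -[u uE].
by case: iS; exists u, j; rewrite -uE; lia.
Qed.

Lemma in_curve_algX (k : fieldType) (a b : nat) (i : nat) :
  in_semigroup a b i -> in_curve_alg a b ('X^i : {poly k}).
Proof.
case=> u [v ->]; exists ('X^u *: 'X^v).
rewrite linearZ /= map_polyXn hornerZ hornerXn comp_Xn_poly -!exprM.
by rewrite mulnC (mulnC b) exprD.
Qed.

(** All coefficients of a homogeneous element vanish except possibly that of s^n in bidegree (0, n),
    and s^n is available exactly when n lies in S. *)
Lemma curve_alg_hilbert_comp (k : fieldType) (a b m : nat) (n : int) :
  (0 < a)%N -> (0 < b)%N ->
  exists d : nat, dim_quotient (@curve_alg_comp k a b m n) (fun p => p = 0) d
    /\ (m == 0%N)%:R * (`[< int_semigroup a b n >])%:R = d%:Z.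
Proof.
move=> a0 b0; rewrite -natrM mulnb; case: andP => [[/eqP -> /asboolP[u [v nE]]]|h].
  exists 1%N; split=> //; set N := (u * a + v * b)%N in nE.
  apply: (@dim_quotient1 _ _ _ _ 'X^N).
    split=> [|i]; first by apply: in_curve_algX; exists u, v.
    by rewrite coefXn; case: (i =P N) => [->|_]; rewrite ?eqxx.
  move=> z [zA zN]; exists z`_N; split.
    apply/polyP => i; rewrite coefB coefZ coefXn coef0.
    case: (eqVneq i N) => [->|iN]; first by rewrite mulr1 subrr.
    rewrite mulr0 subr0; apply/eqP/negPn/negP => /zN[_]; rewrite nE => -[] /esym.
    exact/eqP.
  move=> c /polyP/(_ N); rewrite coefB coefZ coefXn eqxx mulr1 coef0 => /eqP.
  by rewrite subr_eq0 => /eqP.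
exists 0%N; split=> //; apply: dim_quotient0 => z [zA zn].
apply/polyP => i; rewrite coef0; apply/eqP/negPn/negP => zi; case: h.
have [-> ->] := zn i zi; split=> //; apply/asboolP.
by have [u [v ->]] := in_curve_alg_coef a0 b0 zA zi; exists u, v.
Qed.

Theorem mainTheorem4 (k : fieldType) (a b p : nat)
    (a_gt0 : (0 < a)%N) (b_gt0 : (0 < b)%N) (ab_coprime : coprime a b)
    (char_k : p \in [pchar k]) (p_dvd_a : (p %| a)%N) :
  is_hilbert_series_HH k a b
    ((1 + smono 2 (- (a * b)%N%:Z) * sgeom 2 (- (a * b)%N%:Z)
            * (1 - smono 0 (m2 a b)%:Z))
     * (1 + smono 1 (- b%:Z)) * H1 a b)%S
  /\ is_hilbert_series_curve_alg k a b (H1 a b).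
Proof.
split=> m n; last by rewrite H1E //; apply: curve_alg_hilbert_comp.
have b_neq0 : b%:R != 0 :> k.
  rewrite -(dvdn_pcharf char_k) -prime_coprime ?(pcharf_prime char_k) //.
  exact: coprime_dvdl p_dvd_a ab_coprime.
by rewrite HH_seriesE //; apply: HH_hilbert_comp.
Qed.
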